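(* If $z\in\mathbb{C}$ is a nonzero degree root of a multigraph of order $n$, then $$\frac{1}{n-1}\leq |z|\leq n-1.$$
   Context: A multigraph is finite, may have multiple edges, and has no loops; its order is its number of vertices. The degree polynomial of a multigraph $G$ with vertex set $V$ is $D(G;x)=\sum_{v\in V} x^{\deg(v)}$, where $\deg(v)$ is the number of edges incident with $v$ (counted with multiplicity). A degree root of $G$ is a complex root of $D(G;x)$. *)

(* Defs.v *)
From mathcomp Require Import all_boot all_order all_algebra.
From mathcomp Require Import complex.
From mathcomp Require Import reals.

Set Implicit Arguments.
Unset Strict Implicit.
Unset Printing Implicit Defensive.

Local Open Scope ring_scope.

(* An edge has exactly two endpoints, so there are no loops; parallel edges are
   distinct elements of [edge] with equal [ends].  As usual in graph theory the
   vertex set is nonempty: for the null graph the degree polynomial would be 0,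
   and every complex number a root of it. *)
Record multigraph := Multigraph {
  vertex : finType;
  edge : finType;
  ends : edge -> {set vertex};
  card_ends : forall e, #|ends e| = 2%N;
  vertex_nonempty : (0 < #|vertex|)%N
}.

Definition graph_order (G : multigraph) : nat := #|vertex G|.

Definition deg (G : multigraph) (v : vertex G) : nat :=
  #|[set e : edge G | v \in ends e]|.

Definition degree_poly (A : nzRingType) (G : multigraph) : {poly A} :=
  \sum_(v : vertex G) 'X^(deg v).

Definition degree_root (R : realType) (G : multigraph) (z : R[i]) : Prop :=
  root (degree_poly R[i] G) z.

(* Main.v *)
Require Import Defs.
From mathcomp Require Import all_boot all_order all_algebra.
From mathcomp Require Import complex.
From mathcomp Require Import reals.

Import Order.TTheory GRing.Theory Num.Theory.

(** The degree polynomial of a graph of order [n] is a sum of [n] monomials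
    ['X^(deg v)], and both bounds come from comparing the sizes of these terms at
    the root.

    Upper bound: group the terms of maximal exponent [d] on one side of the
    equation [D(z) = 0].  Being equal, they cannot cancel each other, so their
    sum has modulus at least [`|z| ^+ d]; it is balanced by the at most [n - 1]
    remaining terms, each of modulus at most [`|z| ^+ d.-1] when [1 <= `|z|].
    Hence [`|z| <= n - 1].  When [`|z| <= 1] it is enough that some term is not
    maximal, so that [1 <= n - 1]; otherwise [D(z)] would be [n * z ^+ d], which
    is not 0 ([norm_root_monomial_sum]).

    Lower bound: [z^-1] is a root of the reciprocal polynomial, which is again
    a sum of [n] monomials, so the upper bound applies to it
    ([reciprocal_monomial_sum]). *)

Local Open Scope ring_scope.

Section MonomialSums.

Context {F : numFieldType} {T : finType}.
Implicit Types (f : T -> nat) (z : F).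

(** The terms of maximal exponent are all equal, hence cannot cancel each other:
    whatever their number, the remaining terms must make up for at least
    [`|z|] raised to the maximal exponent. *)
Lemma norm_root_monomial_sum f z : (0 < #|T|)%N -> z != 0 ->
  \sum_v z ^+ f v = 0 -> `|z| <= #|T|%:R - 1.
Proof.
move=> /card_gt0P[x0 _] z0 sum0.
have [v0 _ fmax] := arg_maxnP f (erefl : xpredT x0).
set d := f v0 in fmax.
have zd_gt0 : 0 < `|z| ^+ d by rewrite exprn_gt0 ?normr_gt0.
pose top := [set v | f v == d].
have v0top : v0 \in top by rewrite inE.
have top_gt0 : (0 < #|top|)%N by apply/card_gt0P; exists v0.
have notop_lt v : v \notin top -> (f v < d)%N.
  by rewrite inE ltn_neqAle => ->; apply: fmax.
have sum_top : z ^+ d *+ #|top| = - \sum_(v in ~: top) z ^+ f v.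
  move/eqP: sum0; rewrite (bigID (mem top)) /= addr_eq0 => /eqP sum0.
  rewrite -sumr_const (eq_bigr (fun v => z ^+ f v)); last first.
    by move=> v; rewrite inE => /eqP->.
  by rewrite sum0; congr (- _); apply: eq_bigl => v; rewrite !inE.
have cobound : #|~: top|%:R <= #|T|%:R - 1 :> F.
  by rewrite lerBrDr natr1 ler_nat -(cardsC top) -add1n leq_add2r.
have zd_le : `|z| ^+ d <= \sum_(v in ~: top) `|z| ^+ f v.
  apply: (@le_trans _ _ `|z ^+ d *+ #|top| |).
    by rewrite normrMn normrX -mulr_natr ler_peMr ?ler1n // ltW.
  rewrite sum_top normrN (le_trans (ler_norm_sum _ _ _)) //.
  by apply: ler_sum => v _; rewrite normrX.
apply: le_trans cobound.
(* If [`|z| < 1], it suffices that some exponent is not maximal. *)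
have [z_ge1|z_lt1] := real_leP (real1 F) (normr_real z); last first.
  apply: le_trans (ltW z_lt1) _; rewrite ler1n card_gt0.
  apply: contraTneq zd_gt0 => no_low.
  by rewrite le_gtF // (le_trans zd_le) // no_low big_set0.
(* Multiplying by [`|z|] raises each exponent by one, which for the remaining
   terms still gives at most [d]. *)
rewrite -(ler_pM2r zd_gt0) (le_trans (ler_wpM2l (normr_ge0 z) zd_le)) //.
rewrite mulr_sumr mulr_natl -sumr_const; apply: ler_sum => v.
by rewrite inE => /notop_lt ?; rewrite -exprS ler_weXn2l.
Qed.

(** Multiplying the relation by [z ^- d], for [d] the maximal exponent, turns it
    into a relation of the same kind for [z^-1]. *)
Lemma reciprocal_monomial_sum f z : z != 0 -> \sum_v z ^+ f v = 0 ->
  \sum_v z^-1 ^+ (\max_w f w - f v) = 0.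
Proof.
move=> z0 sum0; set d := \max_w f w.
rewrite (eq_bigr (fun v => z ^- d * z ^+ f v)).
  by rewrite -mulr_sumr sum0 mulr0.
move=> v _; have fv : (f v <= d)%N by apply: leq_bigmax.
by rewrite exprVn -{2}(subnK fv) exprD invfM mulfVK // expf_neq0.
Qed.

End MonomialSums.

Theorem theorem3p2 (R : realType) (n : nat) (G : multigraph) (z : R[i])
    (hn : graph_order G = n) (hz : z != 0) (hroot : degree_root G z) :
  1 / (n%:R - 1) <= `|z| /\ `|z| <= n%:R - 1.
Proof.
rewrite -hn /graph_order.
have V0 := vertex_nonempty G.
have sum0 : \sum_(v : vertex G) z ^+ deg v = 0.
  move/rootP: hroot; rewrite /degree_poly horner_sum => hroot; rewrite -[RHS]hroot.
  by apply: eq_bigr => v _; rewrite hornerXn.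
have upper := norm_root_monomial_sum _ _ V0 hz sum0.
split; last exact: upper.
have n1_gt0 : 0 < #|vertex G|%:R - 1 :> R[i].
  by apply: lt_le_trans upper; rewrite normr_gt0.
have zV0 : z^-1 != 0 by rewrite invr_eq0.
have := norm_root_monomial_sum _ _ V0 zV0 (reciprocal_monomial_sum _ _ hz sum0).
by rewrite normfV div1r invf_ple // posrE normr_gt0.
Qed.
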